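(* Let $k\ge 1$ and $n\ge 1$ be integers, and let $A_k(n)$ be the $kn\times kn$ matrix whose $(i,j)$ entry, for $1\le i,j\le kn$, is $$\genfrac{[}{]}{0pt}{}{\lfloor \frac{i-1}{k}\rfloor+2}{\lfloor \frac{i-1}{k}\rfloor+1+i-j},$$ where $\genfrac{[}{]}{0pt}{}{r}{s}$ denotes the Stirling cycle number. Then $\det A_k(n)$ is the number of unlabeled acyclic single-source automata with $n$ transient states on a $(k+1)$-letter input alphabet.
   Context: Stirling cycle numbers: $\genfrac{[}{]}{0pt}{}{r}{s}$ is the number of permutations of $\{1,\dots,r\}$ with exactly $s$ cycles (so for $r\ge 1$ it is $0$ when $s\le 0$ or $s>r$). Automata: a (complete, deterministic) automaton on an $m$-letter input alphabet consists of a finite set of states and, for each state and each letter, a resulting state. It is viewed as an $m$-regular directed multigraph with ordered edges: from each state there is one outgoing edge for each letter, the edges being ordered by the (ordered) alphabet. The automaton is acyclic if only one vertex, called the sink, is involved in cycles; that is, all edges from the sink are loops back to the sink and no other vertex lies on a directed cycle. The non-sink states are called transient. A source is a vertex with no incoming edges. The automaton is single-source if it has exactly one source. Labeled single-source acyclic automata with $n\ge 1$ transient states have vertices $1,2,\dots,n+1$, where $1$ is the source, $n+1$ is the sink, and $2,\dots,n$ are called the interior vertices. An unlabeled acyclic single-source automaton is an equivalence class of such labeled automata under relabeling (permuting the labels $2,\dots,n$) of the interior vertices; the letters of the alphabet are not permuted. *)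

(* Defs.v *)
From mathcomp Require Import all_boot all_order all_fingroup all_algebra.

Set Implicit Arguments.
Unset Strict Implicit.
Unset Printing Implicit Defensive.

(* The number of cycles s is an integer, since the matrix below also evaluates
   the Stirling cycle numbers at negative s (where they vanish). *)
Definition stirling_cycle (r : nat) (s : int) : nat :=
  #|[set p : {perm 'I_r} | Posz #|porbits p| == s]|.

(* Rows and columns are numbered from 0 here: the row index i and the column
   index j stand for i + 1 and j + 1 in the usual 1-based numbering. *)
Definition stirling_mx (k n : nat) : 'M[int]_(k * n) :=
  (\matrix_(i < k * n, j < k * n)
     Posz (stirling_cycle (i %/ k + 2)
                          (Posz (i %/ k) + 1 + Posz i - Posz j)))%R.

(* A v a is the state reached from the state v by reading the letter a; the
   letters 'I_m are the ordered alphabet. *)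
Definition automaton (m : nat) (V : finType) := {ffun V -> {ffun 'I_m -> V}}.

Section Automata.

Variables (m : nat) (V : finType).
Implicit Types (A : automaton m V) (u v z : V) (p : {perm V}).

Definition edge A : rel V := fun u v => [exists a, A u a == v].

(* A directed cycle through v is an edge from v followed by a (possibly empty)
   directed path back to v; in particular, loops are cycles. *)
Definition on_cycle A v := [exists u, edge A v u && connect (edge A) u v].

Definition acyclic_with_sink A z :=
  [forall a, A z a == z] && [forall v, (v != z) ==> ~~ on_cycle A v].

Definition is_source A v := [forall u, ~~ edge A u v].

Definition sources A : {set V} := [set v | is_source A v].

Definition relabel p A : automaton m V :=
  [ffun v => [ffun a => p (A ((p^-1)%g v) a)]].

End Automata.

(* The vertices 1, ..., n + 1 are the elements of 'I_n.+1, shifted by one: the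
   source is ord0, the sink is ord_max, and the other ordinals are the interior
   vertices. *)
Definition labeled_automata (m n : nat) : {set automaton m 'I_n.+1} :=
  [set A : automaton m 'I_n.+1 |
     acyclic_with_sink A ord_max && (sources A == [set ord0])].

Definition interior_equiv (m n : nat) : rel (automaton m 'I_n.+1) :=
  fun A B => [exists p : {perm 'I_n.+1},
    [&& p ord0 == ord0, p ord_max == ord_max & B == relabel p A]].

Definition unlabeled_automata (m n : nat) : {set {set automaton m 'I_n.+1}} :=
  equivalence_partition (@interior_equiv m n) (labeled_automata m n).

(* Main.v *)
Require Import Defs.
From mathcomp Require Import all_boot all_order all_fingroup all_algebra.
From mathcomp Require Import zify ring.

Set Implicit Arguments.
Unset Strict Implicit.
Unset Printing Implicit Defensive.

Import Order.TTheory GRing.Theory.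

(** Both sides count the same words of length n(k+1) over {0, ..., n-1}.

    Determinant.  The Stirling cycle number [r+1; r+1-t] is the elementary
    symmetric function e_t(1, ..., r) (stirling_cycle_elsym).  With rows and
    columns numbered from 0 and b_i = floor(i/k) + 1, the matrix entry is
    therefore e_{j+1-i}(1, ..., b_i), so the matrix is of Hessenberg type, with
    ones below the diagonal.  Its determinant is a flagged complete symmetric
    function (det_flagged_hsym): the sum of c_1 ... c_N, with N = kn, over the
    sequences c_1 <= ... <= c_N such that 1 <= c_l <= b_{l-1}.  This is a
    flagged Jacobi-Trudi identity; it comes from the sign-reversing involution
    on pairs (sequence c, set S) that moves the larger of the last term of c
    and the maximum of S to the other side.

    Automata.  Number the edges of an automaton by their start vertex, then by
    their letter, and let the last edge into a vertex be the incoming edge of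
    greatest number.  A labeling is canonical if every edge from a transient
    vertex leads to a greater label and the last edges into 1, 2, ..., n come in
    this order.  Every isomorphism class contains exactly one canonical
    automaton.  For existence (exists_canonical_relabel), take, among the
    topological labelings, one whose sequence of last edges is
    lexicographically least: two consecutive labels in the wrong order could be
    exchanged (relabel_swap).  For uniqueness (canonical_relabel_id), an
    isomorphism of canonical automata that fixes all the labels below j also
    fixes j, since j is the vertex not below j whose last edge comes first.

    Words.  List the targets w of the edges as n - w, in the order of the edges.
    Read from right to left, the words of canonical automata are the restricted
    growth words on n letters in which the letter x occurs only after at least
    x(k+1) others (canonical_edge_word).  A letter of such a word either repeats
    one of the c letters already present or is the next new letter; the kn
    repetitions contribute the factors c_1, ..., c_N, and the bound on the
    positions of new letters becomes c_l <= b_{l-1} (size_rgs_words). *)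

(** * Stirling cycle numbers as elementary symmetric functions *)

Lemma porbit_lift_perm_id r (q : {perm 'I_r}) :
  porbit (lift_perm ord_max ord_max q) ord_max = [set ord_max].
Proof.
apply/setP=> z; rewrite inE; apply/porbitP/eqP => [[i ->]|->]; last first.
  by exists 0; rewrite perm1.
by elim: i => [|i IHi]; rewrite ?perm1 // expgSr permM IHi lift_perm_id.
Qed.

Lemma card_porbits_lift_perm r (q : {perm 'I_r}) :
  #|porbits (lift_perm ord_max ord_max q)| = #|porbits q|.+1.
Proof.
set L := lift_perm _ _ q.
have expL i y : ((L ^+ i) (lift ord_max y) = lift ord_max ((q ^+ i) y))%g.
  by elim: i => [|i IHi]; rewrite ?perm1 // !expgSr !permM IHi lift_perm_lift.
have orbL y : porbit L (lift ord_max y) = lift ord_max @: porbit q y.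
  apply/setP=> z; apply/porbitP/imsetP => [[i ->]|[_ /porbitP[i ->] ->]].
    by exists ((q ^+ i)%g y); rewrite ?mem_porbit.
  by exists i.
have -> : porbits L =
    [set ord_max] |: (fun B : {set 'I_r} => lift ord_max @: B) @: porbits q.
  apply/setP=> B; rewrite in_setU1; apply/imsetP/orP => [[z _ ->]|].
    have [y ->|->] := unliftP ord_max z.
      by right; rewrite orbL; apply/imset_f/imset_f.
    by left; rewrite porbit_lift_perm_id.
  case=> [/eqP->|/imsetP[_ /imsetP[y _ ->] ->]].
    by exists ord_max; rewrite ?porbit_lift_perm_id.
  by exists (lift ord_max y).
rewrite cardsU1 card_imset; last exact/imset_inj/lift_inj.
case: imsetP => // -[B _ /setP/(_ ord_max)]; rewrite set11 => /esym/imsetP[y _].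
by move/eqP; rewrite (negPf (neq_lift _ _)).
Qed.

(** The permutation obtained from [xq.2], with the new point fixed, by inserting
    the new point into the cycle of [xq.1] when [xq.1] is an old point. *)
Definition insert_max r (xq : 'I_r.+1 * {perm 'I_r}) : {perm 'I_r.+1} :=
  (tperm xq.1 ord_max * lift_perm ord_max ord_max xq.2)%g.

Lemma insert_max_bij r : bijective (@insert_max r).
Proof.
apply: inj_card_bij => [[x q] [y q']|]; rewrite /insert_max /=; last first.
  by rewrite card_prod card_ord !card_Sn factS.
move=> eqf.
have exy : x = y.
  apply: (@perm_inj _ (tperm x ord_max * lift_perm ord_max ord_max q)%g).
  by rewrite {2}eqf !permM !tpermL !lift_perm_id.
rewrite exy in eqf *; congr (_, _); move/mulgI: eqf => /permP eqL.
apply/permP=> z; apply: (@lift_inj _ ord_max).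
by have := eqL (lift ord_max z); rewrite !lift_perm_lift.
Qed.

(** Inserting the new point into an existing cycle merges its singleton cycle
    with that cycle. *)
Lemma card_porbits_insert_max r x (q : {perm 'I_r}) :
  #|porbits (insert_max (x, q))| = #|porbits q| + (x == ord_max).
Proof.
set L := lift_perm ord_max ord_max q; have := porbits_mul_tperm L x ord_max.
rewrite card_porbits_lift_perm porbit_lift_perm_id inE /insert_max /=.
rewrite -/L; move: (#|porbits (_ * _)%g|) => N; case: eqP => _ /=; lia.
Qed.

Lemma stirling_cycleS r (s : int) :
  stirling_cycle r.+1 s =
    stirling_cycle r (s - 1)%R + r * stirling_cycle r s.
Proof.
have cardE n z : stirling_cycle n z =
    \sum_(p : {perm 'I_n}) (Posz #|porbits p| == z).
  by rewrite /stirling_cycle cardsE -sum1_card big_mkcond.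
rewrite !cardE (reindex (@insert_max r)) /=; last first.
  exact/onW_bij/insert_max_bij.
rewrite -(pair_bigA_idem _ (fun x q => (Posz #|porbits (insert_max (x, q))| == s) : nat)) //=.
rewrite big_ord_recr [RHS]addnC /=; congr (_ + _); last first.
  by apply: eq_bigr => q _; rewrite card_porbits_insert_max eqxx PoszD eq_sym -subr_eq eq_sym.
have -> N : r * N = \sum_(x < r) N by rewrite sum_nat_const card_ord.
apply: eq_bigr => x _.
apply: eq_bigr => q _; rewrite card_porbits_insert_max.
suff -> : (widen_ord (leqnSn r) x == ord_max) = false by rewrite addn0.
by rewrite -val_eqE /= ltn_eqF.
Qed.

Lemma stirling_cycle0 (s : int) : stirling_cycle 0 s = (s == 0%R).
Proof.
rewrite /stirling_cycle.
have h (p : {perm 'I_0}) : #|porbits p| = 0.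
  by apply/eqP; rewrite cards_eq0; apply/eqP/setP=> B; rewrite inE; apply/imsetP=> -[[]].
have [->|s0] := eqVneq s 0%R.
  rewrite -[RHS](card_Sn 0); apply: eq_card => p; rewrite !inE.
  by rewrite h.
by apply/eqP; rewrite cards_eq0; apply/eqP/setP=> p; rewrite !inE h eq_sym (negPf s0).
Qed.

(** * A Hessenberg determinant *)

Section Flagged.

Local Open Scope ring_scope.
Variables (R : comNzRingType) (x : nat -> R).

(** The elementary symmetric polynomial e_t in the variables x_0, ..., x_{c-1}. *)
Fixpoint elsym (c t : nat) : R :=
  if c is c'.+1 then elsym c' t + (if t is t'.+1 then x c' * elsym c' t' else 0)
  else (t == 0)%:R.

Lemma elsym0 c : elsym c 0 = 1.
Proof. by elim: c => //= c ->; rewrite addr0. Qed.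

Variable (b : nat -> nat).

(** The sum of x_{s_1} ... x_{s_i} over the weakly increasing sequences
    s_1 <= ... <= s_i < c with s_l < b (l - 1) for all l: a complete symmetric
    polynomial with flag b.  The recursion removes s_i. *)
Fixpoint flagged_hsym (i c : nat) : R :=
  if i is i'.+1 then \sum_(s < c | (s < b i')%N) x s * flagged_hsym i' s.+1 else 1.

Lemma flagged_hsymS i c :
  flagged_hsym i.+1 c.+1 =
    flagged_hsym i.+1 c + (if (c < b i)%N then x c * flagged_hsym i c.+1 else 0).
Proof. by rewrite /= big_mkcond big_ord_recr -big_mkcond. Qed.

Let T i t : R := \sum_(s < b i) x s * flagged_hsym i s.+1 * elsym s t.

Lemma flagged_hsym_elsym0 c t : flagged_hsym 0 c * elsym c t.+1 =
  \sum_(s < c) x s * flagged_hsym 0 s.+1 * elsym s t.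
Proof.
rewrite mul1r; elim: c => [|c IHc]; first by rewrite big_ord0.
by rewrite big_ord_recr -IHc /= mulr1.
Qed.

(** A pair of a flagged sequence and a strictly increasing sequence, with values
    below c, is classified by its greatest value s: either s occurs in the strict
    sequence, and all the terms of the other one are at most s, or s occurs only in
    the weakly increasing one. *)
Lemma flagged_hsym_elsymS i c t : flagged_hsym i.+1 c * elsym c t.+1 =
  \sum_(s < c) x s * flagged_hsym i.+1 s.+1 * elsym s t
  + \sum_(s < c | (s < b i)%N) x s * flagged_hsym i s.+1 * elsym s t.+1.
Proof.
elim: c => [|c IHc]; first by rewrite !big_ord0 /= big_ord0 mul0r addr0.
rewrite [X in _ + X]big_mkcond !big_ord_recr -big_mkcond /=.
rewrite addrACA -IHc -/(flagged_hsym i.+1 c.+1) -/(flagged_hsym i.+1 c) flagged_hsymS.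
by case: ifP => _; ring.
Qed.

Hypothesis b_mono : {homo b : i j / (i <= j)%N}.

(** The i-th term is T i (m - i - 1) + T (i - 1) (m - i), the two parts of the
    classification by the greatest value (only the first part for i = 0, only the
    second one for i = m), so that the alternating sum telescopes: moving the
    greatest value from one sequence to the other matches the two occurrences of T. *)
Lemma alternating_flagged_hsym_elsym m : (0 < m)%N ->
  \sum_(i < m.+1) (-1) ^+ i * (flagged_hsym i (b i) * elsym (b i) (m - i)) = 0.
Proof.
have below i (F : nat -> R) : \sum_(s < b i.+1 | (s < b i)%N) F s = \sum_(s < b i) F s.
  rewrite (big_ord_widen_cond _ predT F (b_mono (leqnSn i))).
  by apply: eq_bigl => s; rewrite andTb.
case: m => // m _.
have partial l : (l <= m)%N ->
    \sum_(i < l.+1) (-1) ^+ i * (flagged_hsym i (b i) * elsym (b i) (m.+1 - i))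
    = (-1) ^+ l * T l (m - l).
  elim: l => [_|l IHl lt_lm]; first by rewrite big_ord1 /= !subn0 flagged_hsym_elsym0.
  rewrite big_ord_recr IHl 1?ltnW //= -/(flagged_hsym l.+1 _) subSS.
  rewrite -(subnSK lt_lm) flagged_hsym_elsymS.
  rewrite (below l (fun s => x s * flagged_hsym l s.+1 * elsym s (m - l.+1).+1)).
  by rewrite /T exprS; ring.
rewrite big_ord_recr partial //= subnn subnn elsym0 mulr1.
rewrite (below m (fun s => x s * flagged_hsym m s.+1)) /T exprS.
under eq_bigr do rewrite elsym0 mulr1.
by ring.
Qed.

(** The matrix is a minor of the unitriangular matrix U with entries
    e_{j-i}(x_0, ..., x_{b_i - 1}).  By the preceding lemma, the row y of the
    signed values (-1)^i flagged_hsym i (b i) satisfies y U = (1, 0, ..., 0).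
    Replacing the last row of the identity by y gives Y, and Y U is U with last
    row (1, 0, ..., 0); its determinant is y_N on the one hand and, by expansion
    along the last row, (-1)^N times the required minor on the other hand. *)
Lemma det_flagged_hsym N :
  \det (\matrix_(i < N, j < N)
          if (i <= j.+1)%N then elsym (b i) (j.+1 - i) else 0) = flagged_hsym N (b N).
Proof.
set M := \matrix_(i, j) _.
pose U : 'M[R]_N.+1 :=
  \matrix_(i, j) if (i <= j)%N then elsym (b i) (j - i) else 0.
pose y (i : nat) : R := (-1) ^+ i * flagged_hsym i (b i).
pose Y : 'M[R]_N.+1 :=
  \matrix_(i, j) if i == ord_max then y j else (i == j)%:R.
have detU : \det U = 1.
  rewrite -det_tr det_trig.
    by rewrite big1 // => i _; rewrite !mxE leqnn subnn elsym0.
  by apply/is_trig_mxP=> i j lt_ij; rewrite !mxE leqNgt lt_ij.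
have detY : \det Y = y N.
  rewrite det_trig; last first.
    apply/is_trig_mxP=> i j lt_ij; rewrite mxE -!val_eqE /= (ltn_eqF lt_ij).
    by rewrite ltn_eqF // (leq_trans lt_ij) // -ltnS.
  rewrite big_ord_recr /= !mxE eqxx big1 ?mul1r // => i _.
  by rewrite !mxE eqxx -val_eqE /= ltn_eqF.
have YU : Y *m U = \matrix_(i, j) if i == ord_max then (j == ord0)%:R else U i j.
  apply/matrixP=> i j; rewrite !mxE.
  have [->|ne_i] := eqVneq i ord_max; last first.
    rewrite (bigD1 i) //= !mxE (negPf ne_i) eqxx mul1r big1 ?addr0 // => l ne_l.
    by rewrite !mxE (negPf ne_i) eq_sym (negPf ne_l) mul0r.
  transitivity (\sum_(l < j.+1) (-1) ^+ l * (flagged_hsym l (b l) * elsym (b l) (j - l))).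
    rewrite (big_ord_widen _
      (fun l => (-1) ^+ l * (flagged_hsym l (b l) * elsym (b l) (j - l))) (ltn_ord j)).
    rewrite [RHS]big_mkcond; apply: eq_bigr => l _.
    by rewrite !mxE eqxx ltnS; case: ifP => _; rewrite ?mulr0 // mulrA.
  have [->|j0] := eqVneq j ord0.
    by rewrite big_ord1 subnn elsym0 !mul1r.
  by rewrite alternating_flagged_hsym_elsym ?lt0n.
have := det_mulmx Y U; rewrite detU detY mulr1 YU (expand_det_row _ ord_max).
rewrite (bigD1 ord0) //= big1 => [|j j0]; last first.
  by rewrite !mxE eqxx (negPf j0) mul0r.
rewrite !mxE !eqxx mul1r addr0 => eq_det.
apply: (can_inj (signrMK N)).
rewrite /= -/(y N) -eq_det /cofactor addn0; congr (_ * \det _).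
apply/matrixP=> i j; rewrite !mxE.
have lt_i : (lift ord_max i = i :> nat) by rewrite /= /bump leqNgt ltn_ord.
by rewrite eq_sym (negPf (neq_lift _ _)) lt_i /= /bump add1n.
Qed.

End Flagged.

(** * The determinant of the Stirling matrix *)

Lemma stirling_cycle_gt r s : r < s -> stirling_cycle r (Posz s) = 0.
Proof.
elim: r s => [|r IHr] [|s] // lt_rs; first by rewrite stirling_cycle0.
by rewrite stirling_cycleS -addn1 PoszD addrK -PoszD !IHr // ?muln0 // addn1 ltnW.
Qed.

Local Notation succ_int := (fun s : nat => Posz s.+1).

(** Both sides satisfy the same recurrence in r: in
    [r+2; r+2-t] = [r+1; r+1-t] + (r+1) [r+1; r+1-(t-1)] the two terms are the
    parts of e_t(1, ..., r+1) without and with the variable r+1. *)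
Lemma stirling_cycle_elsym r t :
  Posz (stirling_cycle r.+1 (Posz r.+1 - Posz t)%R) = elsym succ_int r t.
Proof.
elim: r t => [|r IHr] t.
  rewrite stirling_cycleS mul0n addn0 stirling_cycle0 /=; case: t => // t.
  by have -> : (1 - Posz t.+1 - 1 == 0)%R = false by lia.
rewrite stirling_cycleS PoszD PoszM.
have -> : (Posz r.+2 - Posz t - 1 = Posz r.+1 - Posz t)%R by lia.
rewrite IHr /=; congr (_ + _)%R; case: t => [|t].
  by rewrite subr0 stirling_cycle_gt ?mulr0.
have -> : (Posz r.+2 - Posz t.+1 = Posz r.+1 - Posz t)%R by lia.
by rewrite IHr.
Qed.

Lemma stirling_mx_elsym k n : stirling_mx k n =
  (\matrix_(i < k * n, j < k * n)
     if (i <= j.+1)%N then elsym succ_int (i %/ k).+1 (j.+1 - i) else 0)%R.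
Proof.
apply/matrixP=> i j; rewrite !mxE addn2; case: leqP => [le_ij|lt_ji].
  rewrite -stirling_cycle_elsym; congr (Posz (stirling_cycle _ _)).
  by rewrite -subzn //; lia.
have -> : (Posz (i %/ k) + 1 + Posz i - Posz j = Posz (i %/ k + (i - j).+1))%R by lia.
by rewrite stirling_cycle_gt //; lia.
Qed.

Lemma det_stirling_mx k n :
  (\det (stirling_mx k n) =
     flagged_hsym succ_int (fun i => (i %/ k).+1) (k * n) ((k * n) %/ k).+1)%R.
Proof.
rewrite stirling_mx_elsym (det_flagged_hsym _ (b := fun i => (i %/ k).+1)) // => i j le_ij.
by rewrite ltnS leq_div2r.
Qed.

(** * Slowly growing words *)

(** Words are built from right to left: a letter x may be added on the left of a
    word that contains all smaller letters and has at least x * m letters. *)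
Fixpoint rgs m s :=
  if s is x :: s' then [&& x * m <= size s', all (mem s') (iota 0 x) & rgs m s']
  else true.

(** The words of length p using exactly the letters 0, ..., j-1; the two parts
    are the words whose leftmost letter is repeated and those where it is new. *)
Fixpoint rgs_words m p j : seq (seq nat) :=
  if p is p'.+1 then
    [seq x :: s | x <- iota 0 j, s <- rgs_words m p' j] ++
    (if j is j'.+1 then
       if j' * m <= p' then [seq j' :: s | s <- rgs_words m p' j'] else [::]
     else [::])
  else if j is 0 then [:: [::]] else [::].

Lemma rgs_down m s x y : rgs m s -> x \in s -> y <= x -> y \in s.
Proof.
elim: s => //= z s IHs /and3P[_ /allP down /IHs{}IHs]; rewrite !inE.
case/predU1P=> [->|/IHs{}IHs /IHs->]; last by rewrite orbT.
rewrite leq_eqVlt => /predU1P[->|lt_yz]; first by rewrite eqxx.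
by apply/orP; right; apply: down; rewrite mem_iota.
Qed.

Lemma rgs_lt_size m s x : rgs m s -> x \in s -> x * m < size s.
Proof.
elim: s => //= z s IHs /and3P[le_z _ /IHs{}IHs]; rewrite inE.
by case/predU1P=> [->|/IHs/leqW].
Qed.

Definition labels j (s : seq nat) := forall x, (x \in s) = (x < j).

Lemma mem_rgs_words m p j s :
  s \in rgs_words m p j <-> [/\ size s = p, rgs m s & labels j s].
Proof.
elim: p j s => [|p IHp] j s.
  case: j => [|j]; rewrite /= ?inE.
    by split=> [/eqP->|[/size0nil->]] //; split=> // x; rewrite ltn0.
  by split=> // -[/size0nil->] _ /(_ 0).
rewrite /= mem_cat; split.
  case/orP=> [/allpairsP[[x s'] [/= xj /IHp[szs' rgs_s' labs'] ->]]|].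
    rewrite mem_iota in xj.
    have xs' : x \in s' by rewrite labs'.
    split; rewrite /= ?szs' //.
      rewrite rgs_s' -szs' ltnW ?(rgs_lt_size rgs_s') //= andbT.
      by apply/allP=> y; rewrite mem_iota => /ltnW; apply: rgs_down rgs_s' xs'.
    by move=> y; rewrite inE -labs'; case: eqP => // ->.
  case: j => // j; case: leqP => // le_jp /mapP[s' /IHp[szs' rgs_s' labs'] ->].
  split; rewrite /= ?szs' ?le_jp ?rgs_s' //= ?andbT.
    by apply/allP=> y; rewrite mem_iota /= labs'.
  by move=> y; rewrite inE labs' [RHS]ltnS [RHS]leq_eqVlt.
case: s => [[]|x s] // [] // [szs] /and3P[le_x /allP down_x rgs_s] lab.
have lt_xj : x < j by rewrite -lab mem_head.
apply/orP; case: (boolP (x \in s)) => [xs|x_s]; [left|right].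
  apply/allpairsP; exists (x, s); split=> //=; first by rewrite mem_iota.
  by apply/IHp; split=> // y; rewrite -lab inE; case: eqP => // ->.
have lab_s : labels x s.
  move=> y; apply/idP/idP => [ys|lt_yx]; last by apply: down_x; rewrite mem_iota.
  by rewrite ltnNge; apply: contra x_s; apply: rgs_down rgs_s ys.
have -> : j = x.+1.
  apply/eqP; rewrite eqn_leq lt_xj andbT leqNgt; apply/negP=> lt_j.
  by have := lab x.+1; rewrite lt_j inE lab_s; lia.
by rewrite szs in le_x; rewrite le_x; apply: map_f; apply/IHp.
Qed.

Lemma rgs_wordsSS m p j : rgs_words m p.+1 j.+1 =
  [seq x :: s | x <- iota 0 j.+1, s <- rgs_words m p j.+1] ++
  (if j * m <= p then [seq j :: s | s <- rgs_words m p j] else [::]).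
Proof. by []. Qed.

Lemma rgs_words_uniq m p j : uniq (rgs_words m p j).
Proof.
elim: p j => [|p IHp] [|j] //.
rewrite rgs_wordsSS cat_uniq allpairs_uniq ?iota_uniq //.
  case: ifP => // _; rewrite map_inj_uniq ?IHp ?andbT => [|s s' []] //.
  apply/hasPn=> _ /mapP[s /mem_rgs_words[_ _ lab] ->].
  apply/negP=> /allpairsP[[x s'] [/= _ /mem_rgs_words[_ _ lab'] [_ eqs]]].
  by have := lab j; rewrite ltnn eqs lab' ltnSn.
by case=> x s [y s'] _ _ [-> ->].
Qed.

Lemma size_rgs_wordsS m p j : size (rgs_words m p.+1 j.+1) =
  j.+1 * size (rgs_words m p j.+1) +
  (if j * m <= p then size (rgs_words m p j) else 0).
Proof.
by rewrite rgs_wordsSS size_cat size_allpairs size_iota; case: ifP; rewrite ?size_map.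
Qed.

Lemma size_rgs_words_lt m p j : p < j -> size (rgs_words m p j) = 0.
Proof.
elim: p j => [|p IHp] [|j] // lt_pj.
by rewrite size_rgs_wordsS !IHp // ?muln0 ?if_same // ltnW.
Qed.

(** A word with j distinct letters and i repetitions has length i + j.  The new
    letter j enters after at least j(k+1) letters, j of which were new, hence
    after at least jk repetitions; the recurrence for the words thus becomes that
    of flagged_hsym, as long as j - 1 can have entered at all. *)
Lemma size_rgs_words k i j : 0 < k ->
  Posz (size (rgs_words k.+1 (i + j) j)) =
    if (j.-1 * k <= i)%N then flagged_hsym succ_int (fun i => (i %/ k).+1) i j else 0%R.
Proof.
move=> k_gt0; elim: i j => [|i IHi]; elim=> [|j IHj] //.
- rewrite !add0n in IHj *; rewrite size_rgs_wordsS size_rgs_words_lt // muln0 add0n.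
  have -> : (j * k.+1 <= j) = (j * k <= 0) by lia.
  by rewrite [j.+1.-1]/=; case: leqP => // le0; rewrite IHj ifT //; nia.
- by rewrite addn0 /= big_ord0.
rewrite addnS size_rgs_wordsS PoszD PoszM addSnnS IHi /=.
have -> : (j * k.+1 <= i + j.+1) = (j * k <= i.+1) by lia.
case: (leqP (j * k) i.+1) => [le_jk|lt_i]; last by rewrite leqNgt ltnW //= mulr0.
rewrite -(addSnnS i j) IHj (leq_trans _ le_jk) ?leq_mul ?leq_pred //.
rewrite -/(flagged_hsym _ _ i.+1 j.+1) flagged_hsymS ltnS leq_divRL // addrC.
by case: ifP => _; rewrite ?mulr0.
Qed.

Lemma det_stirling_mx_rgs_words k n : 0 < k -> 0 < n ->
  (\det (stirling_mx k n) = Posz (size (rgs_words k.+1 (n * k.+1) n)))%R.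
Proof.
move=> k_gt0 n_gt0; have -> : n * k.+1 = k * n + n by rewrite mulnSr mulnC.
rewrite size_rgs_words // ifT; last by rewrite mulnC leq_mul ?leq_pred.
rewrite det_stirling_mx mulKn //.
have: 0 < k * n by rewrite muln_gt0 k_gt0.
case def_N: (k * n) => [//|N] _; rewrite flagged_hsymS ifF ?addr0 //.
by rewrite ltnS leqNgt ltn_divLR // mulnC def_N ltnSn.
Qed.

(** * Transversals and linear extensions *)

Lemma card_equivalence_partition_transversal (T : finType) (R : rel T) (D C : {set T}) :
    {in D & &, equivalence_rel R} -> C \subset D ->
    {in D, forall x, exists2 c, c \in C & R x c} -> {in C &, forall c c', R c c' -> c = c'} ->
  #|equivalence_partition R D| = #|C|.
Proof.
move=> eqR /subsetP sCD repr uniqC.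
pose cls x := [set y in D | R x y].
have -> : equivalence_partition R D = cls @: C.
  apply/setP=> B; apply/imsetP/imsetP => [[x Dx ->]|[c Cc ->]]; last first.
    by exists c; rewrite ?sCD.
  have [c Cc Rxc] := repr x Dx; exists c => //; apply/setP=> y; rewrite !inE.
  by case: (boolP (y \in D)) => //= Dy; have [_ ->] := eqR x c y Dx (sCD c Cc) Dy.
apply: card_in_imset => c c' Cc Cc' /setP/(_ c'); rewrite !inE !sCD //=.
have [-> _] := eqR _ _ _ (sCD c' Cc') (sCD c' Cc') (sCD c' Cc').
exact: uniqC.
Qed.

(** The permutation sorts by f, ties being broken by the original order. *)
Lemma exists_perm_homo N (f : 'I_N -> nat) :
  exists p : {perm 'I_N}, forall u v, f u < f v -> p u < p v.
Proof.
pose g (v : 'I_N) := f v * N + v.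
have g_inj : injective g.
  move=> u v /(congr1 (modn^~ N)); rewrite !modnMDl !modn_small //; exact: val_inj.
pose below v := [set u | g u < g v].
have below_homo u v : g u < g v -> #|below u| < #|below v|.
  move=> lt_uv; apply/proper_card/properP; split.
    by apply/subsetP=> w; rewrite !inE => /ltn_trans; apply.
  by exists u; rewrite !inE ?ltnn.
have lt_below v : #|below v| < N.
  rewrite -[X in _ < X]card_ord -cardsT; apply/proper_card/properP.
  by split; [apply: subsetT | exists v; rewrite !inE ?ltnn].
have p_inj : injective (fun v => Ordinal (lt_below v)).
  move=> u v /(congr1 val)/= eq_uv; apply: g_inj.
  by case: (ltngtP (g u) (g v)) => // /below_homo; rewrite eq_uv ltnn.
exists (perm p_inj) => u v lt_uv; rewrite !permE /=; apply: below_homo.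
rewrite /g (@leq_trans ((f u).+1 * N)) //; first by rewrite mulSnr ltn_add2l.
by rewrite (leq_trans _ (leq_addr _ _)) // leq_mul2r lt_uv orbT.
Qed.

(** * Canonical automata *)

Section Canonical.

Variables k n : nat.
Hypothesis n_gt0 : 0 < n.
Local Notation V := 'I_n.+1.
Local Notation auto := (automaton k.+1 V).
Implicit Types (A B : auto) (u v w : V) (a : 'I_k.+1) (p : {perm V}).

Definition topological A :=
  [forall v, forall a, if v == ord_max then A v a == ord_max else v < A v a].

Lemma topologicalP A :
  reflect ((forall a, A ord_max a = ord_max) /\
           (forall v a, v != ord_max -> v < A v a))
          (topological A).
Proof.
apply: (iffP forallP) => [topo|[topo_max topo] v].
  split=> [a|v a v_max]; first by have /forallP/(_ a) := topo ord_max; rewrite eqxx => /eqP.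
  by have /forallP/(_ a) := topo v; rewrite (negPf v_max).
by apply/forallP=> a; have [->|/topo] := eqVneq v ord_max; rewrite ?topo_max.
Qed.

Definition rank v a := v * k.+1 + a.

Lemma rank_inj v w a b : rank v a = rank w b -> v = w /\ a = b.
Proof.
move=> eq_r; split; apply: val_inj => /=.
  by have := congr1 (divn^~ k.+1) eq_r; rewrite /= !divnMDl ?divn_small ?addn0.
by have := congr1 (modn^~ k.+1) eq_r; rewrite /= !modnMDl !modn_small.
Qed.

Lemma rank_lt v a j : (rank v a < j * k.+1) = (v < j).
Proof. by rewrite /rank -ltn_divLR // divnMDl // divn_small ?addn0. Qed.

(** One more than the number of the last edge into w from a transient vertex, so
    that 0 means that there is no such edge. *)
Definition last_in A w :=
  \max_(e : V * 'I_k.+1 | (e.1 != ord_max) && (A e.1 e.2 == w)) (rank e.1 e.2).+1.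

Lemma last_in_ge A v a : v != ord_max -> rank v a < last_in A (A v a).
Proof.
move=> v_max; apply: (@leq_bigmax_cond _ _ (fun e : V * 'I_k.+1 => (rank e.1 e.2).+1) (v, a)).
by rewrite v_max /=.
Qed.

Lemma last_in_witness A w : 0 < last_in A w ->
  exists v a, [/\ v != ord_max, A v a = w & last_in A w = (rank v a).+1].
Proof.
set P : pred (V * 'I_k.+1) := fun e => (e.1 != ord_max) && (A e.1 e.2 == w).
case: (posnP #|P|) => [/card0_eq P0|cardP]; first by rewrite /last_in big_pred0 //; exact: P0.
have [[v a] /andP[v_max /eqP Aw] eq_last] := eq_bigmax_cond (fun e : V * 'I_k.+1 => (rank e.1 e.2).+1) cardP.
by exists v, a; split=> //; exact: eq_last.
Qed.

Lemma last_in_inj A w w' : 0 < last_in A w -> last_in A w = last_in A w' -> w = w'.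
Proof.
move=> last_w eq_last; have [v [a [_ Avw eq_w]]] := last_in_witness last_w.
rewrite eq_last in last_w; have [v' [a' [_ Avw' eq_w']]] := last_in_witness last_w.
rewrite -Avw -Avw'; have /succn_inj/rank_inj[-> ->] // : (rank v a).+1 = (rank v' a').+1.
by rewrite -eq_w eq_last.
Qed.

Lemma eq_last_in A B w w' :
  (forall v a, v != ord_max -> (A v a == w) = (B v a == w')) -> last_in A w = last_in B w'.
Proof.
move=> eqAB; apply: eq_bigl => -[v a] /=.
by case: (boolP (v == ord_max)) => //= v_max; apply: eqAB.
Qed.

Lemma last_in_le A w : topological A -> last_in A w <= w * k.+1.
Proof.
case/topologicalP=> _ topo; apply/bigmax_leqP => -[v a] /= /andP[v_max /eqP <-].
by rewrite rank_lt topo.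
Qed.

(** The positivity condition makes 0 the only source. *)
Definition canonical : {set auto} :=
  [set A | [&& topological A, [forall w : V, (w != ord0) ==> (0 < last_in A w)] &
            [forall w : V, forall w' : V, (w < w') ==> (last_in A w <= last_in A w')]]].

Lemma canonicalP A :
  reflect [/\ topological A, forall w, w != ord0 -> 0 < last_in A w &
              forall w w' : V, w < w' -> last_in A w <= last_in A w']
          (A \in canonical).
Proof.
rewrite inE; apply: (iffP and3P) => -[topo pos mono]; split=> //.
- by move=> w; have /forallP/(_ w)/implyP := pos.
- by move=> w w'; have /forallP/(_ w)/forallP/(_ w')/implyP := mono.
- by apply/forallP=> w; apply/implyP/pos.
by apply/forallP=> w; apply/forallP=> w'; apply/implyP/mono.
Qed.

Lemma labeledP A :
  reflect [/\ forall a, A ord_max a = ord_max,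
              forall v, v != ord_max -> ~~ on_cycle A v &
              forall v, is_source A v <-> v = ord0]
          (A \in labeled_automata k.+1 n).
Proof.
rewrite inE -andbA; apply: (iffP and3P) => -[sink acyc src]; split.
- by move=> a; apply/eqP; have /forallP := sink.
- by move=> v; have /forallP/(_ v)/implyP := acyc.
- by move=> v; have /eqP/setP/(_ v) := src; rewrite !inE => ->; split=> /eqP.
- by apply/forallP=> a; apply/eqP.
- by apply/forallP=> v; apply/implyP/acyc.
by apply/eqP/setP=> v; rewrite !inE; apply/idP/eqP => /src.
Qed.

Lemma relabelE p A v a : relabel p A (p v) a = p (A v a).
Proof. by rewrite !ffunE permK. Qed.

Lemma relabelM p q A : relabel (p * q)%g A = relabel q (relabel p A).
Proof. by apply/ffunP=> v; apply/ffunP=> a; rewrite !ffunE invMg !permM. Qed.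

Lemma relabelK p A : relabel p^-1%g (relabel p A) = A.
Proof. by apply/ffunP=> v; apply/ffunP=> a; rewrite !ffunE invgK !permK. Qed.

Lemma interior_equiv_equivalence (D : {set auto}) : {in D & &, equivalence_rel (@interior_equiv k.+1 n)}.
Proof.
have refl A : interior_equiv A A.
  apply/existsP; exists 1%g; rewrite !perm1 !eqxx /=.
  by apply/eqP/ffunP=> v; apply/ffunP=> a; rewrite !ffunE invg1 !perm1.
have sym A B : interior_equiv A B -> interior_equiv B A.
  case/existsP=> p /and3P[/eqP p0 /eqP pmax /eqP->].
  apply/existsP; exists p^-1%g.
  by rewrite -{1}p0 -{1}pmax !permK relabelK !eqxx.
have trans A B C : interior_equiv A B -> interior_equiv B C -> interior_equiv A C.
  case/existsP=> p /and3P[/eqP p0 /eqP pmax /eqP->].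
  case/existsP=> q /and3P[/eqP q0 /eqP qmax /eqP->].
  by apply/existsP; exists (p * q)%g; rewrite !permM p0 q0 pmax qmax relabelM !eqxx.
move=> A B C _ _ _; split=> // AB.
by apply/idP/idP => [/(trans _ _ _ (sym _ _ AB))|/(trans _ _ _ AB)].
Qed.

Lemma canonical_labeled : canonical \subset labeled_automata k.+1 n.
Proof.
apply/subsetP=> A /canonicalP[/topologicalP[sink topo] pos _]; apply/labeledP.
have edge_le u v : edge A u v -> u <= v.
  case/existsP=> a /eqP<-; have [->|/topo/ltnW->//] := eqVneq u ord_max.
  by rewrite sink.
split=> // [v v_max|v].
  apply/existsP=> -[u /andP[/existsP[a /eqP def_u] /connectP[q path_q def_v]]].
  suff: u <= v by rewrite leqNgt -def_u topo.
  elim: q u {def_u} path_q def_v => [|w q IHq] u /=; first by move=> _ ->.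
  by case/andP=> /edge_le le_uw path_q def_v; apply: leq_trans le_uw (IHq w _ _).
split=> [/forallP src|->]; last apply/forallP=> u.
  apply/eqP; apply: contraT => /pos/last_in_witness[u [a [_ def_v _]]].
  by case/existsP: (src u); exists a; apply/eqP.
apply/existsP=> -[a /eqP Aua]; have [u_max|/topo] := eqVneq u ord_max.
  by have := congr1 val Aua; rewrite u_max sink /= => n0; move: n_gt0; rewrite n0.
by move/(_ a); rewrite Aua.
Qed.

(** All the edges into j start below j, where p does nothing. *)
Lemma last_in_relabel A p (j : V) : topological A -> p ord_max = ord_max ->
  (forall v : V, v < j -> p v = v) -> last_in (relabel p A) (p j) = last_in A j.
Proof.
move=> /topologicalP[sink topo] pmax fix_p; apply: eq_last_in => v a v_max.
rewrite !ffunE (inj_eq perm_inj).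
have [lt_vj|le_jv] := ltnP v j; first by rewrite -{1}(fix_p v lt_vj) permK.
case: eqP => [Aj|_]; last first.
  by case: eqP => // Aj; have := topo v a v_max; rewrite Aj ltnNge le_jv.
have lt_vj : p^-1%g v < j.
  rewrite -Aj topo //; apply: contra v_max => /eqP eq_v.
  by rewrite -(permKV p v) eq_v pmax.
by have := fix_p _ lt_vj; rewrite permKV => eq_v; rewrite -eq_v ltnNge le_jv in lt_vj.
Qed.

(** If p fixes the labels below j and moves j, then both p j and its preimage
    p^-1 j exceed j.  In either automaton, the last edge into j has the same number
    as the last edge into a greater label of the other automaton.  By monotonicity
    the four numbers are equal, so in relabel p A the labels j and p j have the same
    last edge, and j = p j after all. *)
Lemma canonical_relabel_id A p : A \in canonical -> relabel p A \in canonical ->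
  p ord_max = ord_max -> p = 1%g.
Proof.
set B := relabel p A => /canonicalP[topoA posA monoA] /canonicalP[topoB posB monoB] pmax.
apply/permP=> j; rewrite perm1; move: j.
suff fix_p N (j : V) : j < N -> p j = j by move=> j; apply: (fix_p j.+1).
elim: N j => // N IHN j lt_jN.
have fix_lt (v : V) : v < j -> p v = v by move=> lt_vj; apply: IHN; apply: leq_trans lt_vj _.
have fixV_lt (v : V) : v < j -> p^-1%g v = v.
  by move=> lt_vj; rewrite -{1}(fix_lt v lt_vj) permK.
apply/eqP; apply: contraT => ne_pj.
have lt_pj : j < p j.
  rewrite ltn_neqAle eq_sym val_eqE ne_pj leqNgt; apply: contra ne_pj => /fix_lt.
  by move/perm_inj->.
have lt_pVj : j < p^-1%g j.
  rewrite ltn_neqAle eq_sym val_eqE -(inj_eq (@perm_inj _ p)) permKV eq_sym ne_pj.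
  rewrite leqNgt; apply: contra ne_pj => /fix_lt; rewrite permKV => {1}->.
  by rewrite permKV.
have pVmax : p^-1%g ord_max = ord_max by rewrite -{1}pmax permK.
have lastB : last_in B (p j) = last_in A j := last_in_relabel topoA pmax fix_lt.
have lastA := last_in_relabel topoB pVmax fixV_lt; rewrite relabelK in lastA.
have lastBpj : 0 < last_in B (p j).
  by apply: posB; apply: contraTneq lt_pj => ->.
case/eqP: ne_pj; apply: (last_in_inj lastBpj); apply/eqP.
by rewrite eqn_leq (monoB _ _ lt_pj) lastB -lastA (monoA _ _ lt_pVj).
Qed.

(** The number of ancestors strictly increases along the edges from transient
    vertices. *)
Lemma exists_topological_relabel A : A \in labeled_automata k.+1 n ->
  exists p, topological (relabel p A).
Proof.
case/labeledP=> sink acyc _.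
pose ancestors v := [set u | connect (edge A) u v].
have [p p_homo] := exists_perm_homo (fun v => #|ancestors v|).
have lt_p v a : v != ord_max -> p v < p (A v a).
  move=> v_max; apply: p_homo; apply/proper_card/properP.
  have edge_va : edge A v (A v a) by apply/existsP; exists a.
  split; last first.
    exists (A v a); rewrite !inE ?connect0 //; apply: contra (acyc v v_max) => conn.
    by apply/existsP; exists (A v a); rewrite edge_va.
  by apply/subsetP=> u; rewrite !inE => /connect_trans->//; apply: connect1.
have pmax : p ord_max = ord_max.
  rewrite -[RHS](permKV p); congr (p _); apply/esym/eqP/negPn/negP=> /(lt_p _ ord0).
  by rewrite permKV /= ltnNge -ltnS ltn_ord.
exists p; apply/topologicalP; split=> [a|v a v_max].
  by rewrite -{1}pmax relabelE sink.
by rewrite -{1 2}(permKV p v) relabelE lt_p // -(inj_eq (@perm_inj _ p)) permKV pmax.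
Qed.

(** The loops of the sink exclude every label but the last one, and an edge into
    the label 0 would have to start below 0, so that the label 0 is a source. *)
Lemma topological_relabel_fix A p : A \in labeled_automata k.+1 n ->
  topological (relabel p A) -> p ord0 = ord0 /\ p ord_max = ord_max.
Proof.
case/labeledP=> sink _ src /topologicalP[sinkB topo].
have pmax : p ord_max = ord_max.
  by apply/eqP; apply: contraT => /(topo _ ord0); rewrite relabelE sink ltnn.
split=> //; rewrite -[RHS](permKV p); congr (p _); apply/esym/src/forallP=> u.
apply/existsP=> -[a /eqP Aua].
have : relabel p A (p u) a = ord0 by rewrite relabelE Aua permKV.
have [->|/(topo _ a)] := eqVneq (p u) ord_max; last by move=> lt_u eq0; rewrite eq0 in lt_u.
by rewrite sinkB => /(congr1 val)/= n0; move: n_gt0; rewrite n0.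
Qed.

(** An edge from w to w' = w + 1 would come after all the edges into w, against
    the hypothesis; without such an edge, exchanging w and w' keeps the labeling
    topological.  The edges into labels below w start below w and are not affected. *)
Lemma relabel_swap A (w w' : V) : topological A -> w' = w.+1 :> nat ->
    last_in A w' < last_in A w ->
  let B := relabel (tperm w w') A in
  [/\ topological B, forall u : V, u < w -> last_in B u = last_in A u &
      last_in B w = last_in A w'].
Proof.
move=> topoA def_w' lt_last B; have /topologicalP[sink topo] := topoA.
have lt_wmax v : v < w' -> v != ord_max.
  by apply: contraTneq => ->; rewrite /= -leqNgt -ltnS.
have w_max : w != ord_max by apply: lt_wmax; rewrite def_w'.
have no_edge a : A w a != w'.
  apply/negP=> /eqP Aw; have := last_in_ge A a w_max; rewrite Aw.
  by have := last_in_le w topoA; rewrite /rank; lia.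
have w'_max : w' != ord_max.
  apply: contraNneq (no_edge ord0) => def_max; apply/eqP.
  have w'n : w' = n :> nat by rewrite def_max.
  move: (A w ord0) (topo w ord0 w_max) => t lt_wt; apply: val_inj => /=.
  by have := ltn_ord t; lia.
have tpermE (u : V) : tperm w w' u = (if u == w :> nat then w.+1 else
    if u == w.+1 :> nat then (w : nat) else u) :> nat.
  by rewrite -def_w' !val_eqE; case: tpermP => [->|->|/eqP/negPf-> /eqP/negPf->];
     rewrite ?eqxx //; case: eqP => [->|].
have BE v a : B v a = tperm w w' (A (tperm w w' v) a) by rewrite !ffunE tpermV.
have topoB v a : v != ord_max -> v < B v a.
  move=> v_max; rewrite BE; set u := tperm w w' v.
  have u_max : u != ord_max.
    by rewrite /u; case: tpermP.
  have no_edge_u : u = w -> A u a <> w' by move=> ->; apply/eqP.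
  have def_u := tpermE v; rewrite -/u in def_u.
  move: (A u a) (topo u a u_max) no_edge_u => t lt_ut no_edge_u.
  have {}no_edge_u : u = w :> nat -> t <> w' :> nat.
    by move=> /val_inj/no_edge_u ne_t /val_inj.
  by move: def_u; rewrite tpermE; do ![case: eqP => ?]; lia.
have same_source (x : V) v a : v < w -> (B v a == tperm w w' x) = (A v a == x).
  move=> lt_v; rewrite BE (inj_eq perm_inj) (_ : tperm w w' v = v) //.
  by apply: val_inj; rewrite /= tpermE; do ![case: eqP => ?]; lia.
split.
- apply/topologicalP; split=> // a; rewrite BE.
  have tmax : tperm w w' ord_max = ord_max by rewrite tpermD.
  by rewrite tmax sink tmax.
- move=> u lt_u; apply: eq_last_in => v a v_max.
  have [lt_v|le_v] := ltnP v w.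
    rewrite -(same_source u) //; congr (_ == _); apply: val_inj; rewrite /= tpermE.
    by do ![case: eqP => ?]; lia.
  move: (A v a) (B v a) (topo v a v_max) (topoB v a v_max) => t t' lt_t lt_t'.
  by rewrite -!val_eqE /=; do ![case: eqP => ?] => //; lia.
apply: eq_last_in => v a v_max; have [lt_v|le_v] := ltnP v w.
  by rewrite -(same_source w') // tpermR.
have no_edge_v : v = w -> A v a <> w' by move=> ->; apply/eqP.
move: (A v a) (B v a) (topo v a v_max) (topoB v a v_max) no_edge_v.
move=> t t' lt_t lt_t' no_edge_v.
have {}no_edge_v : v = w :> nat -> t <> w' :> nat.
  by move=> /val_inj/no_edge_v ne_t /val_inj.
by rewrite -!val_eqE /=; do ![case: eqP => ?] => //; lia.
Qed.

(** Among the topological labelings, one with the lexicographically least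
    sequence of last edges is canonical, for an inversion of two consecutive last
    edges could be removed by relabel_swap. *)
Lemma exists_canonical_relabel A : A \in labeled_automata k.+1 n ->
  exists2 B, B \in canonical & interior_equiv A B.
Proof.
move=> labA; have [p0 topo0] := exists_topological_relabel labA.
pose lasts (p : {perm V}) : n.+1.-tuplelexi nat := [tuple last_in (relabel p A) w | w < n.+1].
case: (arg_minP (P := fun p => topological (relabel p A)) lasts topo0) => p topo_p min_p.
have [p_0 p_max] := topological_relabel_fix labA topo_p.
exists (relabel p A); last by apply/existsP; exists p; rewrite p_0 p_max !eqxx /=.
have adjacent (w w' : V) : w' = w.+1 :> nat ->
    last_in (relabel p A) w <= last_in (relabel p A) w'.
  move=> def_w'; rewrite leqNgt; apply/negP=> lt_last.
  have [] := relabel_swap topo_p def_w' lt_last; rewrite -relabelM => topo_q lt_w eq_w.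
  have := min_p _ topo_q; rewrite leNgt => /negP; apply.
  apply/ltxi_tuplePlt; exists w => [u lt_uw|]; rewrite !tnth_mktuple.
    exact: lt_w.
  by rewrite eq_w ltEnat.
have /topologicalP[sink topo] := topo_p.
have /labeledP[_ _ src] := labA.
apply/canonicalP; split=> // [w w0|w w' lt_w].
  have : ~~ is_source A (p^-1%g w).
    by apply: contra w0 => /src eq0; rewrite -(permKV p w) eq0 p_0.
  case/forallPn=> u /negPn/existsP[a /eqP Aua].
  have : relabel p A (p u) a = w by rewrite relabelE Aua permKV.
  have [->|pu_max <-] := eqVneq (p u) ord_max; last exact: leq_trans (last_in_ge _ _ pu_max).
  (* Only the sink is above n - 1, so all the edges from n - 1 lead to it. *)
  rewrite sink => <-; pose v : V := inord n.-1.
  have def_v : v = n.-1 :> nat by rewrite inordK // ltnS leq_pred.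
  have v_max : v != ord_max by rewrite -val_eqE /= def_v; lia.
  suff <- : relabel p A v ord0 = ord_max by apply: leq_trans (last_in_ge _ _ v_max).
  move: (relabel p A v ord0) (topo v ord0 v_max) => t lt_vt.
  by apply: val_inj => /=; have := ltn_ord t; lia.
have [d def_w'] : exists d, w' = w + d :> nat by exists (w' - w); lia.
elim: d w' def_w' {lt_w} => [|d IHd] w' def_w'.
  by rewrite (_ : w' = w) //; apply: val_inj; rewrite /= def_w' addn0.
pose u : V := inord (w + d).
have def_u : u = w + d :> nat by rewrite inordK //; have := ltn_ord w'; lia.
by apply: leq_trans (IHd u def_u) (adjacent _ _ _); lia.
Qed.

Lemma card_unlabeled_automata : #|unlabeled_automata k.+1 n| = #|canonical|.
Proof.
apply: card_equivalence_partition_transversal.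
- exact: interior_equiv_equivalence.
- exact: canonical_labeled.
- exact: exists_canonical_relabel.
move=> A B canA canB /existsP[p /and3P[_ /eqP p_max /eqP def_B]].
rewrite def_B in canB *; rewrite (canonical_relabel_id canA canB p_max).
by apply/ffunP=> v; apply/ffunP=> a; rewrite !ffunE invg1 !perm1.
Qed.

(** * Words of canonical automata *)

(** The target w is written n - w, so that the sink becomes the letter 0 and the
    labels appear in increasing order when the word is read from the right. *)
Definition edge_word A : seq nat :=
  mkseq (fun t => n - A (inord (t %/ k.+1)) (inord (t %% k.+1))) (n * k.+1).

Lemma size_edge_word A : size (edge_word A) = n * k.+1.
Proof. exact: size_mkseq. Qed.

Lemma nth_edge_word A v a : v != ord_max -> nth 0 (edge_word A) (rank v a) = n - A v a.
Proof.
move=> v_max; have lt_vn : v < n by rewrite ltn_neqAle -ltnS ltn_ord andbT.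
rewrite nth_mkseq ?rank_lt // /rank divnMDl // divn_small // addn0 modnMDl modn_small //.
by rewrite !inord_val.
Qed.

Lemma rank_surj t : t < n * k.+1 -> exists v a, v != ord_max /\ rank v a = t.
Proof.
move=> lt_t; have lt_n : t %/ k.+1 < n by rewrite ltn_divLR.
exists (inord (t %/ k.+1)), (inord (t %% k.+1)).
rewrite -val_eqE /= /rank inordK 1?ltnW // inordK ?ltn_mod // -divn_eq.
by rewrite ltn_eqF.
Qed.

(** Positions are counted from the left, so the letters to the right of position
    t are those that come before it in the growth of the word. *)
Lemma rgsP m s :
  reflect (forall t, t < size s -> nth 0 s t * m + t < size s /\
             forall y, y < nth 0 s t -> exists2 t', t < t' < size s & nth 0 s t' = y)
          (rgs m s).
Proof.
elim: s => [|x s IHs] /=; first by apply: ReflectT.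
apply: (iffP and3P) => [[le_x /allP down /IHs{}IHs] [_|t /IHs[lt_t down_t]]|rgs_s] /=.
- rewrite addn0 ltnS; split=> // y lt_y.
  have /nthP-/(_ 0)[t' lt_t' <-] : y \in s by apply: down; rewrite mem_iota.
  by exists t'.+1.
- rewrite addnS ltnS; split=> // y /down_t[t' lt_t' <-]; by exists t'.+1.
split.
- by have [] := rgs_s 0 (ltn0Sn _); rewrite addn0 ltnS.
- apply/allP=> y; rewrite mem_iota => lt_y.
  have [_ /(_ y lt_y)[[|t'] //= lt_t' <-]] := rgs_s 0 (ltn0Sn _).
  exact: mem_nth.
apply/IHs=> t lt_t; have [/= lt_xt down_t] := rgs_s t.+1 lt_t.
split=> [|y /down_t[[|t'] // lt_t' <-]]; first by rewrite addnS in lt_xt.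
by exists t'.
Qed.

Lemma colabel_inj v w : n - v = n - w -> v = w.
Proof. by move=> eq_vw; apply: val_inj => /=; have := ltn_ord v; have := ltn_ord w; lia. Qed.

Lemma exists_colabel y : y < n -> exists2 w : V, w != ord0 & n - w = y.
Proof.
move=> lt_y; have def_w : (inord (n - y) : V) = n - y :> nat by rewrite inordK // ltnS leq_subr.
by exists (inord (n - y)); rewrite -?val_eqE /= def_w; lia.
Qed.

Lemma rank_colabel (w : V) t : ((n - w) * k.+1 + t < n * k.+1) = (t < w * k.+1).
Proof.
have: w * k.+1 <= n * k.+1 by rewrite leq_mul // -ltnS.
by rewrite mulnBl; lia.
Qed.

(** The bound on the letter at an edge says that its target exceeds its start
    vertex.  The growth condition says that an edge into w is followed by an edge
    into w', for each w' > w, which is the monotonicity of the last edges. *)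
Lemma canonical_edge_word A : (forall a, A ord_max a = ord_max) ->
  A \in canonical <-> rgs k.+1 (edge_word A) /\ labels n (edge_word A).
Proof.
move=> sink; have lt_rank v a : v != ord_max -> rank v a < n * k.+1.
  by move=> v_max; rewrite rank_lt ltn_neqAle -ltnS ltn_ord andbT.
split=> [/canonicalP[/topologicalP[_ topo] pos mono]|[/rgsP rgsA labA]].
  split.
    apply/rgsP=> t; rewrite size_edge_word => /rank_surj[v [a [v_max <-]]].
    rewrite nth_edge_word //; split; first by rewrite rank_colabel rank_lt topo.
    move=> y lt_y; have [|w' w'0 def_y] := @exists_colabel y; first by lia.
    have [v' [a' [v'_max def_w' last_w']]] := last_in_witness (pos w' w'0).
    exists (rank v' a'); last by rewrite nth_edge_word // def_w'.
    rewrite lt_rank // andbT; have lt_w' : A v a < w' by lia.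
    have := leq_trans (last_in_ge A a v_max) (mono _ _ lt_w'); rewrite last_w' ltnS.
    rewrite leq_eqVlt => /predU1P[/rank_inj[eq_v eq_a]|//].
    by rewrite -def_w' -eq_v -eq_a ltnn in lt_w'.
  move=> y; apply/idP/idP => [/(nthP 0)[t]|/exists_colabel[w w0 <-]].
    rewrite size_edge_word => /rank_surj[v [a [v_max <-]]]; rewrite nth_edge_word // => <-.
    by have := topo v a v_max; lia.
  have [v [a [v_max <- _]]] := last_in_witness (pos w w0).
  by rewrite -nth_edge_word // mem_nth // size_edge_word lt_rank.
apply/canonicalP; split.
- apply/topologicalP; split=> // v a v_max; have := lt_rank v a v_max.
  by rewrite -(size_edge_word A) => /rgsA[]; rewrite size_edge_word nth_edge_word // rank_colabel rank_lt.
- move=> w w0; have : n - w \in edge_word A by rewrite labA; have := ltn_ord w; move: w0; rewrite -val_eqE /=; lia.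
  case/(nthP 0)=> t; rewrite size_edge_word => /rank_surj[v [a [v_max <-]]].
  rewrite nth_edge_word // => /colabel_inj <-.
  exact: leq_trans (last_in_ge A a v_max).
move=> w w' lt_ww'; apply/bigmax_leqP=> -[v a] /= /andP[v_max /eqP Aw].
have := lt_rank v a v_max; rewrite -(size_edge_word A) => /rgsA[_]; rewrite size_edge_word nth_edge_word //.
case/(_ (n - w')) => [|t' /andP[lt_t' /rank_surj[v' [a' [v'_max def_t']]]]].
  by rewrite Aw; have := ltn_ord w'; lia.
rewrite -def_t' nth_edge_word // => /colabel_inj <-.
by apply: leq_trans (last_in_ge A a' v'_max); rewrite def_t' ltnS ltnW.
Qed.

Lemma card_canonical : #|canonical| = size (rgs_words k.+1 (n * k.+1) n).
Proof.
have sinkP A : A \in canonical -> forall a, A ord_max a = ord_max.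
  by case/canonicalP=> /topologicalP[].
rewrite cardE -(size_map edge_word); apply/perm_size/uniq_perm; last 1 first.
- move=> s; apply/mapP/idP => [[A]|/mem_rgs_words[sz_s rgs_s lab_s]].
    rewrite mem_enum => canA ->; apply/mem_rgs_words; rewrite size_edge_word.
    by have [? ?] := (canonical_edge_word (sinkP A canA)).1 canA.
  pose A : auto := [ffun v => [ffun a =>
    if v == ord_max then ord_max else inord (n - nth 0 s (rank v a))]].
  have sinkA a : A ord_max a = ord_max by rewrite !ffunE eqxx.
  have def_s : s = edge_word A.
    apply: (@eq_from_nth _ 0); rewrite sz_s ?size_edge_word // => t lt_t.
    have lt_x : nth 0 s t < n by rewrite -lab_s mem_nth ?sz_s.
    have [v [a [v_max def_t]]] := rank_surj lt_t; rewrite -def_t in lt_x *.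
    rewrite nth_edge_word // !ffunE (negPf v_max) inordK ?ltnS ?leq_subr //.
    by rewrite subKn // ltnW.
  exists A => //; rewrite mem_enum; apply/(canonical_edge_word sinkA).
  by rewrite -def_s.
- rewrite map_inj_in_uniq ?enum_uniq // => A B; rewrite !mem_enum => /sinkP sA /sinkP sB eqAB.
  apply/ffunP=> v; apply/ffunP=> a; have [->|v_max] := eqVneq v ord_max.
    by rewrite sA sB.
  by apply: colabel_inj; rewrite -!nth_edge_word // eqAB.
exact: rgs_words_uniq.
Qed.

End Canonical.

Theorem mainTheorem1 (k n : nat) (hk : (1 <= k)%N) (hn : (1 <= n)%N) :
  (\det (stirling_mx k n) = Posz #|unlabeled_automata k.+1 n|)%R.
Proof.
by rewrite card_unlabeled_automata // card_canonical // det_stirling_mx_rgs_words.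
Qed.
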